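(* Let $P\in\mathcal{B}(\mathcal{H})$ be an idempotent. Then the following statements are equivalent: (i) There exists a symmetry $J\in\mathcal{B}(\mathcal{H})$ such that $JPJ=I-P$. (ii) $\dim N(P+P^{*})=\dim N(2I-P-P^{*})$. (iii) There exists a unitary operator $U\in\mathcal{B}(\mathcal{H})$ such that $UPU^{*}=I-P$.
   Context: $\mathcal{H}$ is a separable complex Hilbert space and $\mathcal{B}(\mathcal{H})$ is the set of bounded linear operators on $\mathcal{H}$. An idempotent is $P\in\mathcal{B}(\mathcal{H})$ with $P^2=P$ (not necessarily self-adjoint). A symmetry is an operator $J$ with $J=J^*=J^{-1}$. $N(T)$ denotes the null space of $T$; $\dim$ is the Hilbert space dimension. *)

(* Defs.v *)
From HB Require Import structures.
From mathcomp Require Import all_boot all_order all_algebra.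
From mathcomp Require Import all_classical all_reals all_analysis.
From mathcomp Require Import complex.

Set Implicit Arguments.
Unset Strict Implicit.
Unset Printing Implicit Defensive.

Import Order.TTheory GRing.Theory Num.Theory.
Import numFieldNormedType.Exports.

Local Open Scope classical_set_scope.
Local Open Scope ring_scope.
Local Open Scope complex_scope.

(* A complex Hilbert space is a complete normed module H over R[i] whose norm  *)
(* is induced by an inner product dot (inner_norm); dot is linear in its first *)
(* argument and conjugate-linear in its second.                                *)
Section HilbertSpace.
Context {R : realType} {H : completeNormedModType R[i]}.
Implicit Types (dot : {dot H for Num.conj}) (S T J U P : H -> H).
Implicit Types (V W E F : set H).

Definition inner_norm dot := forall x : H, `|x| ^+ 2 = dot x x.

Definition bounded_operator T :=
  linear T /\ exists M : R[i], forall x, `|T x| <= M * `|x|.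

(* adjoint dot T y is the vector z with <T x, y> = <x, z> for all x: it is     *)
(* unique because dot is definite, and it exists when T is a bounded operator  *)
(* by the Riesz representation theorem (0 is only a default value).            *)
Definition adjoint dot T : H -> H :=
  fun y => xget 0 [set z | forall x, dot (T x) y = dot x z].

Definition idempotent_operator P := bounded_operator P /\ P \o P = P.

Definition symmetry_operator dot J :=
  [/\ bounded_operator J, J = adjoint dot J & J \o J = idfun].

Definition unitary_operator dot U :=
  [/\ bounded_operator U,
      U \o adjoint dot U = idfun & adjoint dot U \o U = idfun].

Definition null_space T : set H := [set x | T x = 0].

Definition linear_span E : set H :=
  [set x | exists n (c : 'I_n -> R[i]) (e : 'I_n -> H),
    (forall i, E (e i)) /\ x = \sum_(i < n) c i *: e i].

Definition orthonormal_family dot E :=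
  (forall e, E e -> dot e e = 1) /\
  (forall e f, E e -> E f -> e <> f -> dot e f = 0).

(* Hilbert basis of a closed subspace V; in particular E is included in V.     *)
Definition orthonormal_basis dot V E :=
  orthonormal_family dot E /\ closure (linear_span E) = V.

(* The Hilbert dimension of a closed subspace is the common cardinality of its *)
(* orthonormal bases; two closed subspaces have the same dimension when they   *)
(* have equipotent orthonormal bases.                                          *)
Definition same_hilbert_dim dot V W :=
  exists E F, [/\ orthonormal_basis dot V E, orthonormal_basis dot W F & (E #= F)%card].

End HilbertSpace.

Definition separable_space (T : topologicalType) :=
  exists2 D : set T, countable D & dense D.

(* Main.v *)
Require Import Defs.
From HB Require Import structures.
From mathcomp Require Import all_boot all_order all_algebra.
From mathcomp Require Import all_classical all_reals all_analysis.
From mathcomp Require Import complex.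
From mathcomp Require Import ring lra.

Set Implicit Arguments.
Unset Strict Implicit.
Unset Printing Implicit Defensive.

Import Order.TTheory GRing.Theory Num.Theory.
Import numFieldNormedType.Exports.

Local Open Scope classical_set_scope.
Local Open Scope ring_scope.
Local Open Scope complex_scope.

(** Write Q for the adjoint of P. The vectors killed by P + Q are those killed by
both P and Q, and the vectors killed by 2 I - P - Q are those fixed by both
([null_sumP], [null_cosumP]). These two orthogonal spaces N0 and N1 span the
space N on which P = Q, that is, on which P is an orthogonal projection.

If U is unitary with U P U^-1 = I - P, taking adjoints gives U Q U^-1 = I - Q, so
U maps N0 onto N1 and carries an orthonormal basis of N0 to one of N1
([same_dim_of_unitary]). A symmetry is a unitary operator, so it only remains to
build a symmetry J with J P = (I - P) J when N0 and N1 have the same dimension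
([symmetry_of_same_dim]). It is built separately on N and on the orthogonal
complement of N, two spaces invariant under P and Q.

On N the operator P is 0 on N0 and 1 on N1, and any symmetry which exchanges N0 and
N1 will do. A bijection s between orthonormal bases yields one: the reflection that
fixes all the e + s e and negates all the e - s e ([swap_exists]).

On the complement of N the dimensions do not matter. The self-adjoint operator
K = Q P - P Q satisfies K P = (I - P) K, and its kernel is exactly N
([commutator_kernel]). The relation passes from K to its sign J, because J K^-1 is a
function of K^2 and K^2 commutes with P; and J is a symmetry ([sign_exists]).

The sign needs no spectral theorem. From a square root S of K^2 which commutes with
all that commutes with K^2, the sign is the reflection in the kernel of K - S. The
square root is the limit of an iteration dominated by a scalar one ([sqrt_exists]).
Orthogonal projections and adjoints are obtained by minimising a distance and from
the Riesz representation theorem ([proj_exists], [adjoint_exists]). *)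

(** * The real-valued norm *)

Section Norm.
Context {R : realType} {H : completeNormedModType R[i]}.
Implicit Types (x y z : H) (a b : R[i]).

(** The norm of H has values in R[i], where the order is only partial; estimates
are made on its real part. *)
Definition rnorm x : R := complex.Re `|x|.

Lemma rnormE x : `|x| = (rnorm x)%:C.
Proof. by rewrite /rnorm RRe_real ?normr_real. Qed.

Lemma rnorm_ge0 x : 0 <= rnorm x.
Proof. by rewrite -ler0c -rnormE. Qed.

Lemma rnorm0 : rnorm (0 : H) = 0.
Proof. by rewrite /rnorm normr0. Qed.

Lemma rnorm_eq0 x : (rnorm x == 0) = (x == 0).
Proof. by rewrite -[RHS]normr_eq0 rnormE (inj_eq (@complexI R)). Qed.

Lemma rnormN x : rnorm (- x) = rnorm x.
Proof. by rewrite /rnorm normrN. Qed.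

Lemma rnormBC x y : rnorm (x - y) = rnorm (y - x).
Proof. by rewrite /rnorm distrC. Qed.

Lemma rnormD x y : rnorm (x + y) <= rnorm x + rnorm y.
Proof. by rewrite -lecR rmorphD /=; rewrite -!rnormE ler_normD. Qed.

Lemma Re_normE a : (complex.Re `|a|)%:C = `|a|.
Proof. by rewrite RRe_real ?normr_real. Qed.

Lemma Re_norm_ge0 a : 0 <= complex.Re `|a|.
Proof. by rewrite -ler0c Re_normE normr_ge0. Qed.

Lemma Re_norm_eq0 a : complex.Re `|a| <= 0 -> a = 0.
Proof.
move=> h; apply/eqP; rewrite -normr_eq0 -Re_normE.
by rewrite (inj_eq (@complexI R)) eq_le h Re_norm_ge0.
Qed.

Lemma Re_normD a b : complex.Re `|a + b| <= complex.Re `|a| + complex.Re `|b|.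
Proof. by rewrite -lecR rmorphD /= !Re_normE ler_normD. Qed.

Lemma rnormZ a x : rnorm (a *: x) = complex.Re `|a| * rnorm x.
Proof.
by apply: (@complexI R); rewrite rmorphM /= Re_normE -!rnormE normrZ.
Qed.

Lemma rnormZr (t : R) x : rnorm (t%:C *: x) = `|t| * rnorm x.
Proof. by rewrite rnormZ normc_def /= expr0n /= addr0 sqrtr_sqr. Qed.

Lemma scaler_halves x : (2^-1 : R)%:C *: x + (2^-1 : R)%:C *: x = x.
Proof.
rewrite -scalerDl -rmorphD (_ : 2^-1 + 2^-1 = 1 :> R) ?rmorph1 ?scale1r //.
by field.
Qed.

Lemma rnorm_dist x y z : rnorm (x - z) <= rnorm (x - y) + rnorm (y - z).
Proof. by rewrite -[x - z](subrKA y) rnormD. Qed.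

(** Limits are taken along explicit rates c / n.+1. A bounded operator preserves
such a rate up to the constant, so that exchanging it with a limit is a single
triangle inequality. *)
Lemma le_of_rate (s t c : R) :
  (forall n : nat, s <= t + c / n.+1%:R) -> s <= t.
Proof.
move=> h; apply/ler_addgt0Pr => e e0.
have := h (Num.truncn (c / e)); have := truncnS_gt (c / e).
rewrite ltr_pdivrMr // mulrC -ltr_pdivrMr ?ltr0Sn // => lt1 le2.
by rewrite (le_trans le2) // lerD2l ltW.
Qed.

Lemma eq_of_rate x y (c : R) :
  (forall n : nat, rnorm (x - y) <= c / n.+1%:R) -> x = y.
Proof.
move=> h; apply/eqP; rewrite -subr_eq0 -rnorm_eq0 eq_le rnorm_ge0 andbT.
by apply: (@le_of_rate _ _ c) => n; rewrite add0r.
Qed.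

Lemma rate_small (c e : R) : 0 < e -> exists n : nat, c / n.+1%:R < e.
Proof.
move=> e0; exists (Num.truncn (c / e)); have := truncnS_gt (c / e).
by rewrite ltr_pdivrMr // mulrC -ltr_pdivrMr ?ltr0Sn.
Qed.

Lemma closure_rnorm (A : set H) x :
  closure A x <-> forall e : R, 0 < e -> exists2 y, A y & rnorm (x - y) < e.
Proof.
split=> [cl e e0|h B].
  have e0' : 0 < e%:C :> R[i] by rewrite ltcR.
  have [y [Ay]] := cl _ (nbhsx_ballx x _ e0').
  by rewrite -ball_normE /= rnormE ltcR => ?; exists y.
move=> /nbhs_ballP[e /= e0 eB].
have eE : e = (complex.Re e)%:C by rewrite RRe_real // gtr0_real.
move: e0 eB; rewrite eE ltcR => e0 eB; have [y Ay xy] := h _ e0.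
by exists y; split => //; apply: eB; rewrite -ball_normE /= rnormE ltcR.
Qed.

(** The completeness of H enters the whole proof only through this lemma. *)
Lemma rnorm_complete (u : nat -> H) (c : R) :
  (forall n m, (n <= m)%N -> rnorm (u m - u n) <= c / n.+1%:R) ->
  exists l, forall n, rnorm (u n - l) <= c / n.+1%:R.
Proof.
move=> hu; have hr := @rate_small c.
have cu : cauchy (u @ \oo).
  apply/cauchy_exP => e e0.
  have eE : e = (complex.Re e)%:C by rewrite RRe_real // gtr0_real.
  move: e0; rewrite eE ltcR => e0; have [n rn] := hr _ e0.
  exists (u n); exists n => //= m nm.
  by rewrite -ball_normE /= rnormE ltcR rnormBC (le_lt_trans (hu _ _ nm)).
have /cvg_ex[l /= ul] : cvg (u @ \oo) by exact: cauchy_cvg.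
exists l => n; apply/ler_addgt0Pr => e e0.
have e0' : 0 < e%:C :> R[i] by rewrite ltcR.
have [N _ hN] := (cvgrPdist_lt _ _).1 ul _ e0'.
have := hN (maxn n N) (leq_maxr _ _); rewrite /= rnormE ltcR rnormBC => lt1.
apply: (le_trans (rnorm_dist _ (u (maxn n N)) _)); rewrite rnormBC.
rewrite addrC; apply: lerD; first exact: hu _ _ (leq_maxl n N).
by rewrite rnormBC; exact: ltW.
Qed.

End Norm.

(** * The inner product *)

Section Inner.
Context {R : realType} {H : completeNormedModType R[i]}.
Context (dot : {dot H for Num.conj}) (dot_norm : inner_norm dot).
Implicit Types (x y z : H) (a b : R[i]).

Lemma dotDl x y z : dot (x + y) z = dot x z + dot y z.
Proof. exact: linearDl. Qed.
Lemma dotDr x y z : dot z (x + y) = dot z x + dot z y.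
Proof. exact: linearDr. Qed.
Lemma dotBl x y z : dot (x - y) z = dot x z - dot y z.
Proof. exact: linearBl. Qed.
Lemma dotBr x y z : dot z (x - y) = dot z x - dot z y.
Proof. exact: linearBr. Qed.
Lemma dotNl x z : dot (- x) z = - dot x z.
Proof. exact: linearNl. Qed.
Lemma dotNr x z : dot z (- x) = - dot z x.
Proof. exact: linearNr. Qed.
Lemma dot0l z : dot 0 z = 0.
Proof. exact: linear0l. Qed.
Lemma dot0r z : dot z 0 = 0.
Proof. exact: linear0r. Qed.
Lemma dotZl a x z : dot (a *: x) z = a * dot x z.
Proof. exact: linearZl_LR. Qed.
Lemma dotZr a x z : dot z (a *: x) = conjc a * dot z x.
Proof. exact: linearZr_LR. Qed.
Lemma dotC x y : dot x y = conjc (dot y x).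
Proof. by rewrite hermC expr0 mul1r. Qed.

Lemma Re_dotC x y : complex.Re (dot x y) = complex.Re (dot y x).
Proof. by rewrite dotC; case: (dot y x). Qed.

Lemma rnorm_sqr x : rnorm x ^+ 2 = complex.Re (dot x x).
Proof. by rewrite -dot_norm rnormE -rmorphXn. Qed.

Lemma dot_self_eq0 x : dot x x = 0 -> x = 0.
Proof.
by move=> h; apply/eqP; rewrite -rnorm_eq0 -sqrf_eq0 rnorm_sqr h.
Qed.

Lemma dot_eq0C x y : dot x y = 0 -> dot y x = 0.
Proof. by move=> h; rewrite dotC h conjc0. Qed.

Lemma dot_injr x y : (forall z, dot z x = dot z y) -> x = y.
Proof.
move=> h; apply/eqP; rewrite -subr_eq0; apply/eqP/dot_self_eq0.
by rewrite dotBr h subrr.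
Qed.

Lemma Re_add (a b : R[i]) : complex.Re (a + b) = complex.Re a + complex.Re b.
Proof. by case: a; case: b. Qed.
Lemma Re_opp (a : R[i]) : complex.Re (- a) = - complex.Re a.
Proof. by case: a. Qed.
Lemma Re_realM (t : R) (a : R[i]) : complex.Re (t%:C * a) = t * complex.Re a.
Proof. by case: a => u v /=; rewrite mul0r subr0. Qed.

Lemma rnormD_sqr x y :
  rnorm (x + y) ^+ 2 = rnorm x ^+ 2 + 2 * complex.Re (dot x y) + rnorm y ^+ 2.
Proof.
rewrite !rnorm_sqr dotDl !dotDr !Re_add (Re_dotC y x); ring.
Qed.

Lemma rnormB_sqr x y :
  rnorm (x - y) ^+ 2 = rnorm x ^+ 2 - 2 * complex.Re (dot x y) + rnorm y ^+ 2.
Proof. rewrite rnormD_sqr rnormN dotNr Re_opp; ring. Qed.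

(** Since the norm already satisfies the triangle inequality, squaring that
inequality gives the Cauchy-Schwarz inequality. *)
Lemma Re_dot_le x y : complex.Re (dot x y) <= rnorm x * rnorm y.
Proof.
have h : rnorm (x + y) ^+ 2 <= (rnorm x + rnorm y) ^+ 2.
  by rewrite lerXn2r ?nnegrE ?addr_ge0 ?rnorm_ge0 ?rnormD.
rewrite rnormD_sqr in h; nra.
Qed.

(** Rotating x by the phase of dot x y turns the modulus into a real part. *)
Lemma dot_le x y : complex.Re `|dot x y| <= rnorm x * rnorm y.
Proof.
have [->|n0] := eqVneq (dot x y) 0.
  by rewrite normr0 mulr_ge0 ?rnorm_ge0.
pose w : R[i] := dot x y.
have wE : `|w| = dot ((conjc w / `|w|) *: x) y.
  rewrite dotZl -/w mulrAC [_ * w]mulrC.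
  have -> : w * conjc w = `|w| ^+ 2 by rewrite sqr_normc.
  by rewrite expr2 mulfK ?normr_eq0.
rewrite -/w wE; apply: (le_trans (Re_dot_le _ _)).
rewrite rnormZ normrM normrV ?unitfE ?normr_eq0 // normr_id norm_conjC.
by rewrite divff ?normr_eq0 // mul1r.
Qed.

End Inner.

(** * Closed subspaces and orthogonal projections *)

Section Proj.
Context {R : realType} {H : completeNormedModType R[i]}.
Context (dot : {dot H for Num.conj}) (dot_norm : inner_norm dot).
Implicit Types (x y z : H) (a b : R[i]) (M : set H).

Definition closed_subspace M :=
  [/\ M 0, forall a x y, M x -> M y -> M (a *: x + y) & closed M].

Lemma subspaceD M x y : closed_subspace M -> M x -> M y -> M (x + y).
Proof. by move=> [_ h _] Mx My; rewrite -[x]scale1r; apply: h. Qed.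

Lemma subspaceZ M a x : closed_subspace M -> M x -> M (a *: x).
Proof. by move=> [M0 h _] Mx; rewrite -[_ *: _]addr0; apply: h. Qed.

Lemma subspaceN M x : closed_subspace M -> M x -> M (- x).
Proof. by move=> hM Mx; rewrite -scaleN1r; apply: subspaceZ. Qed.

Lemma subspaceB M x y : closed_subspace M -> M x -> M y -> M (x - y).
Proof. by move=> hM Mx My; apply: subspaceD => //; apply: subspaceN. Qed.

Lemma closed_subspace_lim M (u : nat -> H) (l : H) (c : R) :
  closed_subspace M -> (forall n, M (u n)) ->
  (forall n, rnorm (u n - l) <= c / n.+1%:R) -> M l.
Proof.
move=> [_ _ cM] Mu hu; apply: cM; apply/closure_rnorm => e e0.
have [n hn] := rate_small c e0; exists (u n) => //.
by rewrite rnormBC (le_lt_trans (hu n)).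
Qed.

(** For real t, the square of rnorm (y - t h) is a quadratic function of t, minimal
at 0, with linear coefficient - 2 Re (dot y h). The imaginary part of dot y h is
the real part for the multiple of h by the imaginary unit. *)
Lemma orth_of_minimal M y : closed_subspace M ->
  (forall h, M h -> rnorm y <= rnorm (y - h)) -> forall h, M h -> dot y h = 0.
Proof.
move=> hM ymin.
have Re0 h : M h -> complex.Re (dot y h) = 0.
  move=> Mh; set c := complex.Re (dot y h); set q := rnorm h ^+ 2.
  have q0 : 0 <= q by rewrite sqr_ge0.
  (* close to the minimiser c / q of t^2 q - 2 t c, but meaningful when q = 0 *)
  pose t := c / (q + 1).
  have := ymin _ (subspaceZ t%:C hM Mh).
  rewrite -ler_sqr ?nnegrE ?rnorm_ge0 // (rnormB_sqr dot_norm) dotZr conjc_real.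
  rewrite Re_realM -/c rnormZr exprMn -/q real_normK ?num_real // => hle.
  have tE : t * (q + 1) = c by rewrite /t mulfVK // gt_eqF // ltr_wpDl.
  have t0 : t = 0 by apply/eqP; rewrite -sqrf_eq0; nra.
  by rewrite -tE t0 mul0r.
move=> h Mh; apply/eqP; rewrite eq_complex /= Re0 // eqxx /=.
have := Re0 _ (subspaceZ (0 +i* 1) hM Mh); rewrite dotZr.
by case: (dot y h) => u v /=; rewrite mul0r mulN1r add0r opprK => ->.
Qed.

(** A sequence in M minimising the distance to x is a Cauchy sequence by the
parallelogram law, and its limit is the nearest point of M. *)
Lemma proj_exists M x : closed_subspace M ->
  exists m, M m /\ forall y, M y -> dot (x - m) y = 0.
Proof.
move=> hM; have M0 : M 0 by case: hM.
pose A := [set rnorm (x - m) ^+ 2 | m in M].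
have hA : has_inf A.
  split; first by exists (rnorm (x - 0) ^+ 2), 0.
  by exists 0 => _ [m _ <-]; rewrite sqr_ge0.
have Alb m : M m -> inf A <= rnorm (x - m) ^+ 2.
  by move=> Mm; apply: ge_inf; [case: hA|exists m].
(* an excess 1 / n.+1 ^ 2 in the squared distance gives the rate 2 / n.+1 *)
have /choice[u hu] (n : nat) : exists m,
    M m /\ rnorm (x - m) ^+ 2 < inf A + n.+1%:R^-1 ^+ 2.
  have e0 : 0 < n.+1%:R^-1 ^+ 2 :> R by rewrite exprn_gt0 ?invr_gt0 ?ltr0Sn.
  by have [_ [m Mm <-]] := inf_adherent e0 hA; exists m.
have cauchy n m : (n <= m)%N -> rnorm (u m - u n) <= 2 / n.+1%:R.
  move=> nm; rewrite -ler_sqr ?nnegrE ?rnorm_ge0 ?divr_ge0 //.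
  have [Mn hn] := hu n; have [Mm hm] := hu m.
  have hmid := Alb _ (subspaceZ (2^-1)%:C hM (subspaceD hM Mm Mn)).
  have E1 : x - (2^-1)%:C *: (u m + u n)
      = (2^-1)%:C *: ((x - u m) + (x - u n)).
    by rewrite addrACA -opprD scalerBr [_ *: (x + x)]scalerDr scaler_halves.
  have E2 : u m - u n = (x - u n) - (x - u m).
    by rewrite opprB [RHS]addrC subrKA.
  move: hmid; rewrite E1 rnormZr exprMn real_normK ?num_real //.
  rewrite (rnormD_sqr dot_norm) E2 (rnormB_sqr dot_norm (x - u n)).
  rewrite (Re_dotC dot (x - u n)).
  have le_mn : m.+1%:R^-1 ^+ 2 <= n.+1%:R^-1 ^+ 2 :> R.
    by rewrite ler_sqr ?nnegrE ?invr_ge0 // lef_pV2 ?posrE ?ltr0Sn // ler_nat.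
  have -> : (2 / n.+1%:R) ^+ 2 = 4 * n.+1%:R^-1 ^+ 2 :> R by rewrite exprMn; ring.
  move: hn hm le_mn; generalize (rnorm (x - u n) ^+ 2) (rnorm (x - u m) ^+ 2).
  generalize (complex.Re (dot (x - u m) (x - u n))) (inf A).
  by generalize (n.+1%:R^-1 ^+ 2 : R) (m.+1%:R^-1 ^+ 2 : R) => *; lra.
have [l hl] := rnorm_complete cauchy.
have Ml : M l := closed_subspace_lim hM (fun n => (hu n).1) hl.
exists l; split => //; apply: orth_of_minimal => // h Mh.
rewrite -addrA -opprD; apply: (@le_of_rate _ _ _ 3) => n.
have [_ hn] := hu n; have hb := Alb _ (subspaceD hM Ml Mh).
have r0 : 0 <= n.+1%:R^-1 :> R by rewrite invr_ge0.
have := hl n; move: hn r0; move: (n.+1%:R^-1) => r hn r0 hln.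
have hs : rnorm (x - u n) <= rnorm (x - (l + h)) + r.
  have b0 := rnorm_ge0 (x - (l + h)).
  rewrite -ler_sqr ?nnegrE ?rnorm_ge0 ?addr_ge0 //.
  have := mulr_ge0 b0 r0; lra.
by apply: (le_trans (rnorm_dist _ (u n) _)); lra.
Qed.

(** The default value 0 is only reached when M is not a closed subspace. *)
Definition orth_proj M x : H :=
  xget 0 [set m | M m /\ forall y, M y -> dot (x - m) y = 0].

Lemma projP M x : closed_subspace M ->
  M (orth_proj M x) /\ forall y, M y -> dot (x - orth_proj M x) y = 0.
Proof.
move=> hM; have [m hm] := proj_exists x hM.
exact: (@xgetPex _ 0 [set m | M m /\ forall y, M y -> dot (x - m) y = 0]
  (ex_intro _ m hm)).
Qed.

Lemma proj_in M x : closed_subspace M -> M (orth_proj M x).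
Proof. by move=> /projP-/(_ x)[]. Qed.

Lemma proj_orth M x y : closed_subspace M -> M y -> dot (x - orth_proj M x) y = 0.
Proof. by move=> /projP-/(_ x)[_]; apply. Qed.

Lemma proj_unique M x m : closed_subspace M ->
  M m -> (forall y, M y -> dot (x - m) y = 0) -> orth_proj M x = m.
Proof.
move=> hM Mm hm; apply/eqP; rewrite -subr_eq0; apply/eqP.
have Md : M (orth_proj M x - m) by apply: subspaceB => //; apply: proj_in.
apply: (dot_self_eq0 dot_norm).
rewrite {1}(_ : orth_proj M x - m = (x - m) - (x - orth_proj M x)).
  by rewrite dotBl hm // proj_orth // subrr.
by rewrite opprB [RHS]addrC subrKA.
Qed.

Lemma proj_id M x : closed_subspace M -> M x -> orth_proj M x = x.
Proof. by move=> hM Mx; apply: proj_unique => // y _; rewrite subrr dot0l. Qed.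

Lemma proj_eq0 M x : closed_subspace M ->
  (forall y, M y -> dot x y = 0) -> orth_proj M x = 0.
Proof.
move=> hM hx; apply: proj_unique => //; first by case: hM.
by move=> y; rewrite subr0; apply: hx.
Qed.

Lemma proj_linear M : closed_subspace M -> linear (orth_proj M).
Proof.
move=> hM a x y; apply: proj_unique => //.
  by case: (hM) => _ h _; apply: h; apply: proj_in.
move=> z Mz; rewrite opprD addrACA -scalerBr dotDl dotZl !proj_orth //.
by rewrite mulr0 addr0.
Qed.

Lemma proj_selfadjoint M x y : closed_subspace M ->
  dot (orth_proj M x) y = dot x (orth_proj M y).
Proof.
move=> hM; rewrite -{1}[y](subrK (orth_proj M y)) -{2}[x](subrK (orth_proj M x)).
rewrite dotDr dotDl (proj_orth _ hM (proj_in _ hM)) (dot_eq0C (proj_orth _ hM _)) //.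
by apply: proj_in.
Qed.

Lemma rnorm_proj M x : closed_subspace M -> rnorm (orth_proj M x) <= rnorm x.
Proof.
move=> hM; rewrite -ler_sqr ?nnegrE ?rnorm_ge0 //.
rewrite -{2}[x](subrK (orth_proj M x)) (rnormD_sqr dot_norm).
rewrite (proj_orth _ hM (proj_in _ hM)) /=.
by rewrite mulr0 addr0 lerDr sqr_ge0.
Qed.

End Proj.

(** * Bounded operators and adjoints *)

Section Operators.
Context {R : realType} {H : completeNormedModType R[i]}.
Context (dot : {dot H for Num.conj}) (dot_norm : inner_norm dot).
Implicit Types (x y z : H) (a b : R[i]) (M : set H) (S T : H -> H).

(** Operators are bare functions with a proof of linearity, so the morphism laws are
restated for an explicit proof. *)
Lemma linearB_of T : linear T -> {morph T : x y / x - y}.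
Proof. exact: zmod_morphism_linear. Qed.

Lemma linearZ_of T : linear T -> forall a, {morph T : x / a *: x}.
Proof. exact: scalable_linear. Qed.

Lemma linear0_of T : linear T -> T 0 = 0.
Proof. by move=> hT; rewrite -{1}(subrr (0 : H)) (linearB_of hT) subrr. Qed.

Lemma linearN_of T : linear T -> {morph T : x / - x}.
Proof. by move=> hT x; rewrite -sub0r (linearB_of hT) (linear0_of hT) sub0r. Qed.

Lemma linearD_of T : linear T -> {morph T : x y / x + y}.
Proof.
move=> hT x y.
by rewrite -[y in LHS]opprK (linearB_of hT) (linearN_of hT) opprK.
Qed.

Lemma bounded_operatorP T : bounded_operator T <->
  linear T /\ exists2 c : R, 0 <= c & forall x, rnorm (T x) <= c * rnorm x.
Proof.
split=> [[hT [c hc]]|[hT [c c0 hc]]]; split => //.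
  exists (complex.Re `|c|) => [|x]; first exact: Re_norm_ge0.
  rewrite -lecR rmorphM /= Re_normE -!rnormE -[X in _ * X]normr_id.
  by rewrite -normrM ger0_norm ?hc // (le_trans _ (hc x)) ?normr_ge0.
by exists c%:C => x; rewrite !rnormE -rmorphM lecR.
Qed.

Lemma orth_closed_subspace y : closed_subspace [set x | dot x y = 0].
Proof.
split; first exact: dot0l.
  by move=> a x z /= hx hz; rewrite dotDl dotZl hx hz mulr0 addr0.
move=> x clx /=; apply: Re_norm_eq0.
apply: (@le_of_rate _ _ _ (rnorm y)) => n; rewrite add0r.
have e0 : 0 < n.+1%:R^-1 :> R by rewrite invr_gt0 ltr0Sn.
have [w /= hw hxw] := (closure_rnorm _ _).1 clx _ e0.
have -> : dot x y = dot (x - w) y by rewrite dotBl hw subr0.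
by rewrite (le_trans (dot_le dot_norm _ _)) // mulrC ler_wpM2l ?rnorm_ge0 // ltW.
Qed.

Lemma preimage_closed_subspace T M : bounded_operator T ->
  closed_subspace M -> closed_subspace [set x | M (T x)].
Proof.
move=> /bounded_operatorP[hT [c c0 hc]] hM.
split; first by rewrite /= (linear0_of hT); case: hM.
  by move=> a x z /= hx hz; rewrite hT; case: hM => _ + _; apply.
move=> x clx /=; have [_ _] := hM; apply; apply/closure_rnorm => e e0.
have e0' : 0 < e / (c + 1) by rewrite divr_gt0 // ltr_wpDl.
have [w /= hw hxw] := (closure_rnorm _ _).1 clx _ e0'.
exists (T w) => //; rewrite -(linearB_of hT) (le_lt_trans (hc _)) //.
rewrite ltr_pdivlMr ?ltr_wpDl // in hxw.
by have := rnorm_ge0 (x - w); lra.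
Qed.

Lemma closed_subspace0 : closed_subspace [set (0 : H)].
Proof.
split=> //; first by move=> a x y -> ->; rewrite scaler0 addr0.
move=> x clx; apply: (@eq_of_rate _ _ _ _ 1) => n.
have e0 : 0 < n.+1%:R^-1 :> R by rewrite invr_gt0 ltr0Sn.
by have [_ -> /ltW] := (closure_rnorm _ _).1 clx _ e0; rewrite div1r.
Qed.

Lemma null_closed_subspace T : bounded_operator T -> closed_subspace (null_space T).
Proof. by move=> hT; apply: (preimage_closed_subspace hT closed_subspace0). Qed.

(** Riesz representation of the functional f x = dot (T x) y. If w is orthogonal to
the kernel of f and f w <> 0, then x - (f x / f w) w lies in the kernel, hence is
orthogonal to w, which computes f x from dot x w. *)
Lemma adjoint_exists T y : bounded_operator T ->
  exists z, forall x, dot (T x) y = dot x z.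
Proof.
move=> bT; have hT : linear T := bT.1.
have [f0|/existsNP[x0 fx0]] := pselect (forall x, dot (T x) y = 0).
  by exists 0 => x; rewrite dot0r.
pose M := [set x | dot (T x) y = 0].
have hM : closed_subspace M := preimage_closed_subspace bT (orth_closed_subspace y).
pose w := x0 - orth_proj dot M x0.
have fw : dot (T w) y != 0.
  apply/eqP; rewrite (linearB_of hT) dotBl; have := proj_in dot_norm x0 hM.
  by rewrite /M /= => ->; rewrite subr0.
have w0 : dot w w != 0.
  apply: contra_neq fw => /(dot_self_eq0 dot_norm) ->.
  by rewrite (linear0_of hT) dot0l.
exists (conjc (dot (T w) y / dot w w) *: w) => x.
rewrite dotZr conjcK.
have Mx : M (x - (dot (T x) y / dot (T w) y) *: w).
  by rewrite /M /= (linearB_of hT) (linearZ_of hT) dotBl dotZl mulfVK // subrr.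
have /dot_eq0C := proj_orth dot_norm x0 hM Mx.
rewrite -/w dotBl dotZl => /eqP; rewrite subr_eq0 => /eqP ->.
by rewrite mulrCA mulfVK // mulfVK.
Qed.

Lemma adjointP T x y : bounded_operator T -> dot (T x) y = dot x (adjoint dot T y).
Proof.
move=> bT; rewrite /adjoint.
have [z hz] := adjoint_exists y bT.
exact: (@xgetPex _ 0 [set z | forall x, dot (T x) y = dot x z]
  (ex_intro _ z hz) x).
Qed.

Lemma adjoint_unique T T' : bounded_operator T ->
  (forall x y, dot (T x) y = dot x (T' y)) -> adjoint dot T = T'.
Proof.
move=> bT h; apply/funext => y; apply: (dot_injr dot_norm) => x.
by rewrite -adjointP.
Qed.

(** With z the image of y under the adjoint of T,
rnorm z ^ 2 = dot (T z) y <= c * rnorm z * rnorm y. *)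
Lemma bounded_adjoint T : bounded_operator T -> bounded_operator (adjoint dot T).
Proof.
move=> bT; have [hT [c c0 hc]] := (bounded_operatorP T).1 bT.
apply/bounded_operatorP; split.
  move=> a x y; apply: (dot_injr dot_norm) => z.
  by rewrite -adjointP // !dotDr !dotZr !adjointP.
exists c => // y; set z := adjoint dot T y.
have : rnorm z ^+ 2 <= c * rnorm z * rnorm y.
  rewrite (rnorm_sqr dot_norm) {2}/z -adjointP //.
  rewrite (le_trans (Re_dot_le dot_norm _ _)) //.
  by rewrite ler_wpM2r ?rnorm_ge0.
have := rnorm_ge0 z; rewrite le_eqVlt => /orP[/eqP <- _|z0].
  by rewrite mulr_ge0 ?rnorm_ge0.
by rewrite expr2 mulrAC [_ * _ * rnorm z]mulrC ler_pM2l.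
Qed.

Lemma bounded_id : bounded_operator (idfun : H -> H).
Proof.
by apply/bounded_operatorP; split=> //; exists 1 => // x; rewrite mul1r.
Qed.

Lemma bounded_comp S T :
  bounded_operator S -> bounded_operator T -> bounded_operator (S \o T).
Proof.
move=> /bounded_operatorP[hS [c c0 hc]] /bounded_operatorP[hT [d d0 hd]].
apply/bounded_operatorP; split; first by move=> a x y; rewrite /= hT hS.
exists (c * d); rewrite ?mulr_ge0 // => x /=.
by rewrite (le_trans (hc _)) // -mulrA ler_wpM2l.
Qed.

Lemma bounded_add S T :
  bounded_operator S -> bounded_operator T -> bounded_operator (S + T).
Proof.
move=> /bounded_operatorP[hS [c c0 hc]] /bounded_operatorP[hT [d d0 hd]].
apply/bounded_operatorP; split.
  by move=> a x y; rewrite !fctE hT hS scalerDr addrACA.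
exists (c + d); rewrite ?addr_ge0 // => x; rewrite fctE.
by rewrite (le_trans (rnormD _ _)) // mulrDl lerD.
Qed.

Lemma bounded_scale a T : bounded_operator T -> bounded_operator (a *: T).
Proof.
move=> /bounded_operatorP[hT [d d0 hd]]; apply/bounded_operatorP; split.
  by move=> b x y; rewrite !fctE hT scalerDr !scalerA mulrC.
exists (complex.Re `|a| * d); rewrite ?mulr_ge0 ?Re_norm_ge0 // => x.
by rewrite fctE rnormZ -mulrA ler_wpM2l ?Re_norm_ge0.
Qed.

Lemma bounded_opp T : bounded_operator T -> bounded_operator (- T).
Proof.
move=> bT; rewrite -scaleN1r; exact: bounded_scale.
Qed.

Lemma bounded_sub S T :
  bounded_operator S -> bounded_operator T -> bounded_operator (S - T).
Proof. by move=> bS bT; apply: bounded_add => //; apply: bounded_opp. Qed.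

Lemma bounded_proj M : closed_subspace M -> bounded_operator (orth_proj dot M).
Proof.
move=> hM; apply/bounded_operatorP; split; first exact: proj_linear.
by exists 1 => // x; rewrite mul1r rnorm_proj.
Qed.

End Operators.

(** * Square roots by iteration *)

Section SquareRoot.
Context {R : realType} {H : completeNormedModType R[i]}.
Context (dot : {dot H for Num.conj}) (dot_norm : inner_norm dot).
Implicit Types (x y z : H) (a b : R[i]) (M : set H) (S T C K : H -> H).

Definition selfadjoint T := forall x y, dot (T x) y = dot x (T y).

Definition contractive T := forall x, rnorm (T x) <= rnorm x.

(** The operator I - Y is a square root of I - C exactly when Y = (C + Y^2) / 2;
this is the fixed point iteration for Y, started at 0. *)
Fixpoint sqrt_iter C n : H -> H :=
  if n is n'.+1 then
    fun x => (2^-1)%:C *: (C x + sqrt_iter C n' (sqrt_iter C n' x))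
  else fun _ => 0.

(** The same iteration for the number C = 1. It increases to 1 and dominates the
iteration of a contractive operator, both in norm and in increments. *)
Fixpoint sqrt_rate n : R :=
  if n is n'.+1 then 2^-1 * (1 + sqrt_rate n' * sqrt_rate n') else 0.

(** The gap t = 1 - sqrt_rate n is replaced by t - t^2 / 2 at each step, which keeps
it below 2 / (n + 2). *)
Lemma sqrt_rate_bound n :
  [/\ 0 <= sqrt_rate n, sqrt_rate n <= 1 &
      (1 - sqrt_rate n) * (n%:R + 2) <= 2].
Proof.
elim: n => [|n [h0 h1 h2]] /=; first by split; rewrite ?ler01 //; lra.
have n0 : 0 <= n%:R :> R by [].
rewrite -[n.+1]addn1 natrD; move: (sqrt_rate n) n%:R h0 h1 h2 n0 => s m h0 h1 h2 m0.
by split; nra.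
Qed.

Lemma sqrt_rate_le n : 1 - sqrt_rate n <= 2 / n.+1%:R.
Proof.
have [h0 h1 h2] := sqrt_rate_bound n; rewrite ler_pdivlMr ?ltr0Sn //.
rewrite -[n.+1]addn1 natrD.
by move: (sqrt_rate n) n%:R h0 h1 h2 => s m h0 h1 h2; nra.
Qed.

Section Iterates.
Context (C : H -> H) (linC : linear C) (leC : contractive C).

Local Notation Y := (sqrt_iter C).

Lemma sqrt_iter_linear n : linear (Y n).
Proof.
elim: n => [|n IH] a x y /=; first by rewrite scaler0 addr0.
rewrite linC !IH addrACA -scalerDr [LHS]scalerDr; congr (_ + _).
by rewrite !scalerA [in LHS]mulrC.
Qed.

Lemma sqrt_iter_le n x : rnorm (Y n x) <= sqrt_rate n * rnorm x.
Proof.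
elim: n x => [|n IH] x /=; first by rewrite rnorm0 mul0r.
have [h0 _ _] := sqrt_rate_bound n.
rewrite rnormZr ger0_norm ?invr_ge0 // -mulrA ler_pM2l ?invr_gt0 //.
apply: (le_trans (rnormD _ _)); rewrite mulrDl mul1r lerD //.
by apply: (le_trans (IH _)); rewrite -mulrA ler_wpM2l.
Qed.

Lemma sqrt_iter_contractive n : contractive (Y n).
Proof.
move=> x; have [h0 h1 _] := sqrt_rate_bound n.
apply: (le_trans (sqrt_iter_le n x)).
by rewrite ler_piMl ?rnorm_ge0.
Qed.

(** The iterates are polynomials in C; this is the form in which the fact is
needed. *)
Lemma sqrt_iter_comm T n : linear T -> (forall x, T (C x) = C (T x)) ->
  forall x, T (Y n x) = Y n (T x).
Proof.
move=> hT TC; elim: n => [|n IH] x /=; first exact: linear0_of.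
by rewrite (linearZ_of hT) (linearD_of hT) TC !IH.
Qed.

Lemma sqrt_iter_commY n m x : Y m (Y n x) = Y n (Y m x).
Proof.
apply: sqrt_iter_comm; first exact: sqrt_iter_linear.
by move=> z; rewrite (sqrt_iter_comm (T := C)).
Qed.

(** The iterates commute, so the difference of the squares of two of them is the
product of their sum and their difference; the scalar iteration satisfies the same
identity with nonnegative factors. *)
Lemma sqrt_iter_step n x :
  rnorm (Y n.+1 x - Y n x) <= (sqrt_rate n.+1 - sqrt_rate n) * rnorm x.
Proof.
elim: n x => [|n IH] x.
  by rewrite !subr0 (le_trans (sqrt_iter_le 1 x)).
have [h0 _ _] := sqrt_rate_bound n; have [h0' _ _] := sqrt_rate_bound n.+1.
set d := Y n.+1 x - Y n x.
have E : Y n.+2 x - Y n.+1 x = (2^-1)%:C *: (Y n.+1 d + Y n d).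
  rewrite [Y n.+2 x]/= [Y n.+1 x in X in _ - X]/= -scalerBr; congr (_ *: _).
  rewrite /d (linearB_of (sqrt_iter_linear n.+1)) (linearB_of (sqrt_iter_linear n)).
  by rewrite (sqrt_iter_commY n n.+1) subrKA opprD addrACA subrr add0r.
rewrite E rnormZr ger0_norm ?invr_ge0 //.
have hd := IH x; rewrite -/d in hd.
have hY1 := sqrt_iter_le n.+1 d; have hY0 := sqrt_iter_le n d.
have hD := rnormD (Y n.+1 d) (Y n d).
have -> : sqrt_rate n.+2 - sqrt_rate n.+1 = 
  2^-1 * ((sqrt_rate n.+1 + sqrt_rate n) * (sqrt_rate n.+1 - sqrt_rate n)).
  have e2 : sqrt_rate n.+2 = 2^-1 * (1 + sqrt_rate n.+1 * sqrt_rate n.+1) by [].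
  have e1 : sqrt_rate n.+1 = 2^-1 * (1 + sqrt_rate n * sqrt_rate n) by [].
  rewrite e2; move: (sqrt_rate n.+1) e1 => s e1; lra.
rewrite -!mulrA ler_pM2l ?invr_gt0 //; apply: (le_trans hD).
apply: (@le_trans _ _ ((sqrt_rate n.+1 + sqrt_rate n) * rnorm d)).
  by rewrite mulrDl lerD.
by rewrite ler_wpM2l // addr_ge0.
Qed.

Lemma sqrt_iter_cauchy n m x : (n <= m)%N ->
  rnorm (Y m x - Y n x) <= 2 * rnorm x / n.+1%:R.
Proof.
move=> nm; have [_ h1 _] := sqrt_rate_bound m.
have : rnorm (Y m x - Y n x) <= (sqrt_rate m - sqrt_rate n) * rnorm x.
  elim: m nm {h1} => [|m IH].
    by rewrite leqn0 => /eqP ->; rewrite !subrr rnorm0 mul0r.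
  rewrite leq_eqVlt => /orP[/eqP ->|]; first by rewrite !subrr rnorm0 mul0r.
  rewrite ltnS => /IH h; apply: (le_trans (rnorm_dist _ (Y m x) _)).
  have := sqrt_iter_step m x; rewrite !mulrBl in h *; lra.
move=> h; apply: (le_trans h); rewrite mulrAC ler_wpM2r ?rnorm_ge0 //.
by apply: le_trans (sqrt_rate_le n); rewrite lerD2r.
Qed.

End Iterates.

(** The square root S of I - C is I - Y, with Y the limit of the iterates. The last
clause records that S is a limit of polynomials in C, and stands in for a
functional calculus. *)
Lemma sqrt_exists C : linear C -> contractive C -> selfadjoint C ->
  exists S, [/\ bounded_operator S, selfadjoint S,
    forall x, S (S x) = x - C x &
    forall T, bounded_operator T -> (forall x, T (C x) = C (T x)) ->
      forall x, T (S x) = S (T x)].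
Proof.
move=> linC leC saC.
have /choice[Y hY] x : exists l, forall n,
    rnorm (sqrt_iter C n x - l) <= 2 * rnorm x / n.+1%:R.
  by apply: rnorm_complete => n m nm; apply: sqrt_iter_cauchy.
have Ylin : linear Y.
  move=> a x y.
  pose c := 2 * (rnorm (a *: x + y)) + complex.Re `|a| * (2 * rnorm x) + 2 * rnorm y.
  apply: (@eq_of_rate _ _ _ _ c) => n.
  apply: (le_trans (rnorm_dist _ (sqrt_iter C n (a *: x + y)) _)).
  have h1 := hY (a *: x + y) n.
  have h2 : rnorm (sqrt_iter C n (a *: x + y) - (a *: Y x + Y y))
     <= complex.Re `|a| * (2 * rnorm x / n.+1%:R) + 2 * rnorm y / n.+1%:R.
    rewrite (sqrt_iter_linear linC) opprD addrACA -scalerBr.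
    apply: (le_trans (rnormD _ _)); rewrite lerD ?hY // rnormZ.
    by rewrite ler_wpM2l ?Re_norm_ge0.
  rewrite rnormBC; apply: (le_trans (lerD h1 h2)).
  by rewrite /c; move: (n.+1%:R^-1) (complex.Re `|a|) => r s; lra.
have Yle : contractive Y.
  move=> x; apply: (@le_of_rate _ _ _ (2 * rnorm x)) => n.
  rewrite -[Y x](subrK (sqrt_iter C n x)) (le_trans (rnormD _ _)) // addrC.
  by rewrite lerD ?(sqrt_iter_contractive leC) // rnormBC.
have Ycomm T : bounded_operator T -> (forall x, T (C x) = C (T x)) ->
    forall x, T (Y x) = Y (T x).
  move=> /bounded_operatorP[hT [c c0 hc]] TC x.
  apply: (@eq_of_rate _ _ _ _ (c * (2 * rnorm x) + 2 * rnorm (T x))) => n.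
  apply: (le_trans (rnorm_dist _ (T (sqrt_iter C n x)) _)).
  rewrite mulrDl lerD //; last by rewrite sqrt_iter_comm.
  rewrite -(linearB_of hT) (le_trans (hc _)) // -mulrA ler_wpM2l // rnormBC.
  exact: hY.
have Ysa : selfadjoint Y.
  move=> x y; apply/eqP; rewrite -subr_eq0; apply/eqP/Re_norm_eq0.
  apply: (@le_of_rate _ _ _ (4 * rnorm x * rnorm y)) => n; rewrite add0r.
  have saY : forall n, selfadjoint (sqrt_iter C n).
    elim=> [|k IH] u v /=; first by rewrite dot0l dot0r.
    by rewrite dotZl dotZr conjc_real dotDl dotDr saC !IH.
  have -> : dot (Y x) y - dot x (Y y)
      = dot (Y x - sqrt_iter C n x) y + dot x (sqrt_iter C n y - Y y).
    by rewrite dotBl dotBr saY subrKA.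
  apply: (le_trans (Re_normD _ _)).
  have h1 := dot_le dot_norm (Y x - sqrt_iter C n x) y.
  have h2 := dot_le dot_norm x (sqrt_iter C n y - Y y).
  have h3 := hY x n; have h4 := hY y n; rewrite rnormBC in h3.
  have h5 := ler_wpM2r (rnorm_ge0 y) h3; have h6 := ler_wpM2l (rnorm_ge0 x) h4.
  apply: (le_trans (lerD (le_trans h1 h5) (le_trans h2 h6))).
  by move: (n.+1%:R^-1) => r; lra.
have Yfix x : Y x = (2^-1)%:C *: (C x + Y (Y x)).
  apply: (@eq_of_rate _ _ _ _ (4 * rnorm x)) => n.
  apply: (le_trans (rnorm_dist _ (sqrt_iter C n.+1 x) _)) => /=.
  have h1 : rnorm (sqrt_iter C n.+1 x - Y x) <= 2 * rnorm x / n.+1%:R.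
    apply: (le_trans (hY _ _)); rewrite ler_wpM2l ?mulr_ge0 ?rnorm_ge0 //.
    by rewrite lef_pV2 ?posrE ?ltr0Sn // ler_nat.
  rewrite rnormBC; apply: (le_trans (lerD h1 (lexx _))) => /=.
  rewrite -scalerBr opprD addrACA subrr add0r rnormZr ger0_norm ?invr_ge0 //.
  set u := sqrt_iter C n x.
  have h2 := rnorm_dist (sqrt_iter C n u) (sqrt_iter C n (Y x)) (Y (Y x)).
  have h3 := hY (Y x) n.
  have h4 : rnorm (sqrt_iter C n u - sqrt_iter C n (Y x)) <= 2 * rnorm x / n.+1%:R.
    rewrite -(linearB_of (sqrt_iter_linear linC n)).
    exact: (le_trans (sqrt_iter_contractive leC n _)) (hY x n).
  have h5 : rnorm (sqrt_iter C n (Y x) - Y (Y x)) <= 2 * rnorm x / n.+1%:R.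
    apply: (le_trans h3); rewrite ler_wpM2r ?invr_ge0 // ler_wpM2l //.
  move: h2 h4 h5; move: (n.+1%:R^-1) => r h2 h4 h5; lra.
exists (idfun - Y); split.
- apply: bounded_sub; first exact: bounded_id.
  apply/bounded_operatorP; split => //.
  by exists 1 => // x; rewrite mul1r.
- by move=> x y; rewrite !fctE dotBl dotBr Ysa.
- move=> x; rewrite !fctE (linearB_of Ylin).
  have h := scaler_halves (C x + Y (Y x)); rewrite -Yfix in h.
  have -> : C x = Y x + Y x - Y (Y x) by rewrite h addrK.
  by rewrite -[Y x + Y x - _]addrA [in RHS]opprD [RHS]addrA.
- by move=> T bT TC x; rewrite !fctE (linearB_of bT.1) Ycomm.
Qed.

End SquareRoot.

(** * Symmetries *)

Section Reflections.
Context {R : realType} {H : completeNormedModType R[i]}.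
Context (dot : {dot H for Num.conj}) (dot_norm : inner_norm dot).
Implicit Types (x y : H) (M N : set H) (T J : H -> H).

Lemma symmetry_operatorP J : symmetry_operator dot J <->
  [/\ bounded_operator J, selfadjoint dot J & forall x, J (J x) = x].
Proof.
split=> [[bJ aJ JJ]|[bJ sJ JJ]]; split => //.
- by move=> x y; rewrite {2}aJ; apply: adjointP.
- by move=> x; move/(congr1 (@^~ x)): JJ.
- by rewrite (adjoint_unique dot_norm bJ sJ).
- exact/funext.
Qed.

Definition reflection M x := orth_proj dot M x + orth_proj dot M x - x.

Lemma reflection_symmetry M : closed_subspace M ->
  symmetry_operator dot (reflection M).
Proof.
move=> hM; have bQ := bounded_proj dot_norm hM.
have linQ : linear (orth_proj dot M) := bQ.1.
have bJ : bounded_operator (reflection M).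
  exact: (bounded_sub (bounded_add bQ bQ) bounded_id).
apply/symmetry_operatorP; split=> // [x y|x].
  rewrite /reflection dotBl dotDl dotBr dotDr.
  by rewrite (proj_selfadjoint dot_norm x y hM).
have QJ : orth_proj dot M (reflection M x) = orth_proj dot M x.
  rewrite /reflection (linearB_of linQ) (linearD_of linQ).
  by rewrite (proj_id dot_norm hM (proj_in dot_norm x hM)) addrK.
by rewrite {1}/reflection QJ /reflection opprB [_ + (x - _)]addrC subrK.
Qed.

Lemma reflection_id M x : closed_subspace M -> M x -> reflection M x = x.
Proof. by move=> hM Mx; rewrite /reflection (proj_id dot_norm hM Mx) addrK. Qed.

Lemma reflection_opp M x : closed_subspace M ->
  (forall y, M y -> dot x y = 0) -> reflection M x = - x.
Proof. by move=> hM hx; rewrite /reflection (proj_eq0 dot_norm hM hx) !add0r. Qed.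

(** A symmetry that preserves N also preserves the orthogonal complement of N, so
its values on these two spaces can be chosen independently. *)
Lemma glue_symmetries N J0 J1 : closed_subspace N ->
  symmetry_operator dot J0 -> symmetry_operator dot J1 ->
  (forall x, N x -> N (J0 x)) -> (forall x, N x -> N (J1 x)) ->
  exists J, [/\ symmetry_operator dot J, forall x, N x -> J x = J1 x &
    forall x, (forall y, N y -> dot x y = 0) -> J x = J0 x].
Proof.
move=> hN /symmetry_operatorP[bJ0 sJ0 JJ0] /symmetry_operatorP[bJ1 sJ1 JJ1] N0 N1.
pose Q := orth_proj dot N; have bQ : bounded_operator Q := bounded_proj dot_norm hN.
have linQ : linear Q := bQ.1.
have QN x : N (Q x) := proj_in dot_norm x hN.
have QQ x : Q (Q x) = Q x by apply: proj_id.
have sQ : selfadjoint dot Q by move=> x y; apply: proj_selfadjoint.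
have QJ T : bounded_operator T -> selfadjoint dot T -> (forall x, N x -> N (T x)) ->
    forall x, Q (T x) = T (Q x).
  move=> bT sT NT x; apply: proj_unique => //; first exact: NT.
  move=> y Ny; rewrite -(linearB_of bT.1) sT.
  by apply: proj_orth => //; apply: NT.
have QJ0 := QJ _ bJ0 sJ0 N0; have QJ1 := QJ _ bJ1 sJ1 N1.
pose J x := J0 (x - Q x) + J1 (Q x).
have J_N x : N x -> J x = J1 x.
  move=> Nx; have Qx : Q x = x by apply: proj_id.
  by rewrite /J Qx subrr (linear0_of bJ0.1) add0r.
exists J; split=> //; last first.
  move=> x xN; have Qx : Q x = 0 by apply: proj_eq0.
  by rewrite /J Qx subr0 (linear0_of bJ1.1) addr0.
apply/symmetry_operatorP; split.
- have bJ0Q := bounded_comp bJ0 (bounded_sub bounded_id bQ).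
  exact: (bounded_add bJ0Q (bounded_comp bJ1 bQ)).
- move=> x y; rewrite /J dotDl dotDr (linearB_of bJ0.1) (linearB_of bJ0.1).
  by rewrite dotBl dotBr !sJ0 !sJ1 !sQ !QJ0 !QJ1.
- move=> x; have QJx : Q (J x) = J1 (Q x).
    rewrite /J (linearD_of linQ) QJ0 QJ1 QQ (linearB_of linQ) QQ subrr.
    by rewrite (linear0_of bJ0.1) add0r.
  by rewrite {1}/J QJx /J addrK JJ0 JJ1 subrK.
Qed.

End Reflections.

(** * The sign of a self-adjoint operator *)

Section Sign.
Context {R : realType} {H : completeNormedModType R[i]}.
Context (dot : {dot H for Num.conj}) (dot_norm : inner_norm dot).
Implicit Types (x y z : H) (M : set H) (S T K J : H -> H).

(** Let S be a self-adjoint square root of K^2 commuting with all that commutes with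
K^2, and J the reflection in the kernel of K - S, which is the sign of K with value
1 on the kernel of K. As (K - S) (K + S) = 0, the operator K + S vanishes on the
complement of this kernel, and so S J = K. If K T = T' K and K T' = T K, then T'
commutes with K^2, hence with S, and S (J T - T' J) = K T - T' K = 0. Finally
S and K have the same kernel because S^2 = K^2. *)
Lemma sign_of_contractive K : bounded_operator K -> selfadjoint dot K ->
  contractive K ->
  exists J, [/\ symmetry_operator dot J, forall x, K x = 0 -> J x = x &
    forall T T', bounded_operator T -> bounded_operator T' ->
      (forall x, K (T x) = T' (K x)) -> (forall x, K (T' x) = T (K x)) ->
      forall x, K (J (T x) - T' (J x)) = 0].
Proof.
move=> bK sK cK; have linK : linear K := bK.1.
pose C := idfun - (K \o K).
have bC : bounded_operator C := bounded_sub bounded_id (bounded_comp bK bK).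
have CE x : C x = x - K (K x) by [].
have cC : contractive C.
  move=> x; rewrite -ler_sqr ?nnegrE ?rnorm_ge0 // CE (rnormB_sqr dot_norm).
  rewrite -[dot x _]sK -(rnorm_sqr dot_norm).
  have := cK (K x); rewrite -[rnorm (K (K x)) <= _]ler_sqr ?nnegrE ?rnorm_ge0 // => h.
  by have := sqr_ge0 (rnorm (K x)); lra.
have sC : selfadjoint dot C by move=> x y; rewrite !CE dotBl dotBr !sK.
have [S [bS sS SS Scomm]] := sqrt_exists dot_norm bC.1 cC sC.
have linS : linear S := bS.1.
have SSK x : S (S x) = K (K x) by rewrite SS CE subKr.
have SK x : S (K x) = K (S x).
  by rewrite -(Scomm K bK) // => z; rewrite !CE (linearB_of linK).
have normS x : rnorm (S x) = rnorm (K x).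
  apply/eqP; rewrite -(@eqrXn2 _ 2) ?rnorm_ge0 // !(rnorm_sqr dot_norm).
  by rewrite sS SSK -sK.
have S_K0 x : S x = 0 -> K x = 0.
  by move=> Sx; apply/eqP; rewrite -rnorm_eq0 -normS Sx rnorm0.
have K_S0 x : K x = 0 -> S x = 0.
  by move=> Kx; apply/eqP; rewrite -rnorm_eq0 normS Kx rnorm0.
pose M := null_space (K - S).
have hM : closed_subspace M := null_closed_subspace (bounded_sub bK bS).
have ME x : M x <-> K x = S x.
  rewrite /M /null_space /= !fctE.
  by split=> [/eqP|->]; rewrite ?subrr // subr_eq0 => /eqP.
have SJ x : S (reflection dot M x) = K x.
  have := proj_in dot_norm x hM; rewrite /reflection; set q := orth_proj dot M x.
  move=> /ME Kq.
  have w0 : K (x - q) + S (x - q) = 0.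
    apply: (dot_injr dot_norm) => z; rewrite dot0r dotDr -sK -sS -dotDl.
    apply: dot_eq0C.
    apply: (proj_orth dot_norm) => //; apply/ME.
    by rewrite (linearD_of linK) (linearD_of linS) SSK SK addrC.
  rewrite (linearB_of linS) (linearD_of linS) -{1}Kq.
  apply/eqP; rewrite eq_sym -subr_eq0 -w0 (linearB_of linK) (linearB_of linS).
  by rewrite -[K q + _ - _]addrA opprD opprB addrA.
exists (reflection dot M); split.
- exact: reflection_symmetry.
- by move=> x Kx; apply: reflection_id => //; apply/ME; rewrite Kx K_S0.
move=> T T' bT bT' KT KT' x; apply: S_K0.
have ST' z : T' (S z) = S (T' z).
  by apply: Scomm => // y; rewrite !CE (linearB_of bT'.1) KT' KT.
by rewrite (linearB_of linS) SJ -ST' SJ KT subrr.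
Qed.

(** Rescaling K changes neither its kernel nor its intertwining relations. *)
Lemma sign_exists K : bounded_operator K -> selfadjoint dot K ->
  exists J, [/\ symmetry_operator dot J, forall x, K x = 0 -> J x = x &
    forall T T', bounded_operator T -> bounded_operator T' ->
      (forall x, K (T x) = T' (K x)) -> (forall x, K (T' x) = T (K x)) ->
      forall x, K (J (T x) - T' (J x)) = 0].
Proof.
move=> bK sK; have [linK [c c0 hc]] := (bounded_operatorP K).1 bK.
pose t : R := (c + 1)^-1.
have t0 : 0 < t by rewrite invr_gt0 ltr_wpDl.
pose K' := t%:C *: K.
have K'E x : K' x = t%:C *: K x by [].
have tC0 : t%:C != 0 :> R[i] by rewrite (inj_eq (@complexI R)) gt_eqF.
have K'0 x : (K' x = 0) <-> (K x = 0).
  rewrite K'E; split=> [/eqP|->]; last by rewrite scaler0.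
  by rewrite scaler_eq0 (negPf tC0) => /eqP.
have bK' : bounded_operator K' by apply: bounded_scale.
have sK' : selfadjoint dot K'.
  by move=> x y; rewrite !K'E dotZl dotZr conjc_real sK.
have cK' : contractive K'.
  move=> x; rewrite K'E rnormZr gtr0_norm // /t mulrC ler_pdivrMr ?ltr_wpDl //.
  by have := hc x; have := rnorm_ge0 x; lra.
have [J [symJ J1 JT]] := sign_of_contractive bK' sK' cK'.
exists J; split=> // [x Kx|T T' bT bT' KT KT' x].
  by apply: J1; apply/K'0.
apply/K'0; apply: JT => // z.
  by rewrite !K'E KT (linearZ_of bT'.1).
by rewrite !K'E KT' (linearZ_of bT.1).
Qed.

End Sign.

(** * Orthonormal bases *)

Section Bases.
Context {R : realType} {H : completeNormedModType R[i]}.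
Context (dot : {dot H for Num.conj}) (dot_norm : inner_norm dot).
Implicit Types (x y : H) (a : R[i]) (M V W E : set H) (U : H -> H).

Lemma orthogonal_closed_subspace E :
  closed_subspace [set x | forall e, E e -> dot x e = 0].
Proof.
split=> [e _|a x y hx hy e Ee|x clx e Ee] /=; first exact: dot0l.
  by rewrite dotDl dotZl hx // hy // mulr0 addr0.
have [_ _ cl] := orth_closed_subspace dot_norm e.
by apply: cl; apply: closure_subset clx => y /(_ _ Ee).
Qed.

Lemma closure_span_sub E M : closed_subspace M -> E `<=` M ->
  closure (linear_span E) `<=` M.
Proof.
move=> hM EM x clx; have [M0 _ cM] := hM; apply: cM.
apply: closure_subset clx => _ [n [c [e [Ee ->]]]].
apply: (big_ind M) => // [y z|i _]; first exact: subspaceD.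
by apply: subspaceZ => //; exact: EM.
Qed.

Lemma linear_span_sub E : E `<=` linear_span E.
Proof.
by move=> x Ex; exists 1%N, (fun _ => 1), (fun _ => x); rewrite big_ord1 scale1r.
Qed.

Lemma basis_sub V E : orthonormal_basis dot V E -> E `<=` V.
Proof.
by move=> [_ <-] x Ex; apply: subset_closure; apply: linear_span_sub.
Qed.

Lemma linear_span_lin E a x y :
  linear_span E x -> linear_span E y -> linear_span E (a *: x + y).
Proof.
move=> [n [c [e [Ee ->]]]] [m [d [f [Ff ->]]]].
exists (n + m)%N,
  (fun i => match fintype.split i with inl j => a * c j | inr k => d k end),
  (fun i => match fintype.split i with inl j => e j | inr k => f k end).
split=> [i|]; first by case: (fintype.split i).
rewrite big_split_ord /= scaler_sumr; congr (_ + _); apply: eq_bigr => i _.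
  by rewrite (unsplitK (inl i)) scalerA.
by rewrite (unsplitK (inr i)).
Qed.

Lemma closure_span_closed_subspace E : closed_subspace (closure (linear_span E)).
Proof.
split; last exact: closed_closure.
  apply: subset_closure; exists 0%N, (fun _ => 0), (fun _ => 0).
  by rewrite big_ord0; split=> // -[].
move=> a x y clx cly; apply/closure_rnorm => e e0.
pose k := complex.Re `|a| + 1.
have k0 : 0 < k by rewrite ltr_wpDl ?Re_norm_ge0.
have e1 : 0 < e / 2 / k by rewrite !divr_gt0.
have e2 : 0 < e / 2 by rewrite divr_gt0.
have [u Eu xu] := (closure_rnorm _ _).1 clx _ e1.
have [v Ev yv] := (closure_rnorm _ _).1 cly _ e2.
exists (a *: u + v); first exact: linear_span_lin.
rewrite opprD addrACA -scalerBr (le_lt_trans (rnormD _ _)) // rnormZ.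
rewrite ltr_pdivlMr // /k in xu.
have := rnorm_ge0 (x - u); lra.
Qed.

Lemma orthonormal_setU1 E w : orthonormal_family dot E -> dot w w = 1 ->
  (forall e, E e -> dot w e = 0) -> orthonormal_family dot (w |` E).
Proof.
move=> [E1 E0] w1 wE; split=> [e [->|/E1]|e f] //.
move=> [->|Ee] [->|Ef] // ef; [exact: wE|exact/dot_eq0C/wE|exact: E0].
Qed.

(** A maximal orthonormal subset of V spans a dense subspace of V: otherwise, from
a vector of V outside the closed span, subtract its projection and normalise. *)
Lemma orthonormal_basis_exists V : closed_subspace V ->
  exists E, orthonormal_basis dot V E.
Proof.
move=> hV; pose good E := orthonormal_family dot E /\ E `<=` V.
have [F Fgood Ftot|E [[onE EV] Emax]] := @Zorn_bigcup H good.
  split; last by move=> x [E FE Ex]; exact: (Fgood _ FE).2.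
  split=> [e [E FE Ee]|e f [E FE Ee] [E' FE' Ef]].
    exact: (Fgood _ FE).1.1.
  have [EE'|EE'] := Ftot _ _ FE FE'.
    by apply: (Fgood _ FE').1.2 => //; apply: EE'.
  by apply: (Fgood _ FE).1.2 => //; apply: EE'.
exists E; split => //; set M := closure (linear_span E).
have hM : closed_subspace M := closure_span_closed_subspace E.
have MV : M `<=` V := closure_span_sub hV EV.
apply/seteqP; split => // x Vx; apply: contrapT => nMx.
pose w := x - orth_proj dot M x.
have w0 : w != 0.
  apply: contra_notN nMx; rewrite subr_eq0 => /eqP ->; exact: proj_in.
have Vw : V w by apply: subspaceB => //; apply: MV; apply: proj_in.
have wE e : E e -> dot w e = 0.
  move=> Ee; apply: proj_orth => //; apply: subset_closure.
  exact: linear_span_sub.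
pose t := (rnorm w)^-1; pose v := t%:C *: w.
have t0 : rnorm w != 0 by rewrite rnorm_eq0.
have vv : dot v v = 1.
  rewrite -dot_norm rnormE rnormZr ger0_norm ?invr_ge0 ?rnorm_ge0 //.
  by rewrite mulVf // rmorph1 expr1n.
have vE e : E e -> dot v e = 0 by move=> /wE h; rewrite dotZl h mulr0.
apply: (Emax (v |` E)); last first.
  split; first exact: orthonormal_setU1.
  by move=> y [->|/EV //]; apply: subspaceZ.
split; first by move=> y Ey; right.
move=> /(_ v (or_introl erefl)) /vE.
by rewrite vv => /eqP; rewrite oner_eq0.
Qed.

Lemma unitary_image_basis V W U : closed_subspace W ->
  bounded_operator U ->
  (forall x y, dot (U x) (U y) = dot x y) ->
  (forall x, V x -> W (U x)) -> (forall y, W y -> exists2 x, V x & U x = y) ->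
  forall E, orthonormal_basis dot V E -> orthonormal_basis dot W (U @` E).
Proof.
move=> hW bU isoU UVW WUV E bE; have EV := basis_sub bE.
have [[E1 E0] clE] := bE; split; first split.
- by move=> _ [e Ee <-]; rewrite isoU E1.
- move=> _ _ [e Ee <-] [f Ef <-] ef; rewrite isoU E0 //.
  by move=> eqef; apply: ef; rewrite eqef.
apply/seteqP; split.
  by apply: closure_span_sub => // _ [e Ee <-]; apply: UVW; apply: EV.
move=> y /WUV[x Vx <-].
have hM := preimage_closed_subspace bU (closure_span_closed_subspace (U @` E)).
rewrite -clE in Vx; apply: (closure_span_sub hM _ Vx) => e Ee /=.
by apply: subset_closure; apply: linear_span_sub; exists e.
Qed.

(** For e, f in E the vectors e + s e and f - s f are orthogonal, so the reflection
in the orthogonal complement of all the f - s f fixes the former and negates the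
latter, that is, exchanges e and s e. By continuity it exchanges the closed
spans. Reflections make it unnecessary to sum series over the bases. *)
Lemma swap_exists V W : closed_subspace V -> closed_subspace W ->
  (forall x y, V x -> W y -> dot x y = 0) -> same_hilbert_dim dot V W ->
  exists J, [/\ symmetry_operator dot J,
    forall x, V x -> W (J x) & forall x, W x -> V (J x)].
Proof.
move=> hV hW VW [E [F [bE bF /card_set_bijP[s [sEF sinj ssurj]]]]].
have EV := basis_sub bE; have FW := basis_sub bF.
pose G := [set x | forall e, E e -> dot x (e - s e) = 0].
have hG : closed_subspace G.
  have := orthogonal_closed_subspace [set e - s e | e in E].
  congr closed_subspace; apply/seteqP; split=> x /= hx.
    by move=> e Ee; apply: hx; exists e.
  by move=> _ [e Ee <-]; apply: hx.
have Gadd e : E e -> G (e + s e).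
  move=> Ee f Ef; rewrite dotBr !dotDl.
  have [[normE ortE] [normF ortF]] :
    orthonormal_family dot E /\ orthonormal_family dot F.
    by case: bE bF => + _ [].
  rewrite (VW _ _ (EV _ Ee) (FW _ (sEF _ Ef))).
  rewrite (dot_eq0C (VW _ _ (EV _ Ef) (FW _ (sEF _ Ee)))) addr0 add0r.
  have [->|ef] := pselect (e = f).
    by rewrite normE // normF ?subrr //; apply: sEF.
  rewrite ortE // ortF ?subrr //; try exact: sEF.
  by move=> /sinj; rewrite !inE => /(_ Ee Ef).
pose J := reflection dot G.
have symJ : symmetry_operator dot J := reflection_symmetry dot_norm hG.
have [bJ _ JJ] := (symmetry_operatorP dot_norm J).1 symJ.
have Jbasis e : E e -> J e = s e.
  move=> Ee; have J1 : J (e + s e) = e + s e.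
    by apply: reflection_id => //; apply: Gadd.
  have J2 : J (e - s e) = - (e - s e).
    by apply: reflection_opp => // y Gy; apply: dot_eq0C; apply: Gy.
  have JD : J e + J e = s e + s e.
    have D : e + e = (e + s e) + (e - s e) by rewrite addrACA subrr addr0.
    rewrite -(linearD_of bJ.1) D (linearD_of bJ.1) J1 J2.
    by rewrite opprB addrC addrA subrK.
  by rewrite -[LHS]scaler_halves -scalerDr JD scalerDr scaler_halves.
exists J; split => // x.
  have [_ <-] := bE => hx.
  apply: (closure_span_sub (preimage_closed_subspace bJ hW) _ hx) => e Ee /=.
  by rewrite Jbasis //; apply: FW; apply: sEF.
have [_ <-] := bF => hx.
apply: (closure_span_sub (preimage_closed_subspace bJ hV) _ hx) => f Ff /=.
by have [e Ee <-] := ssurj _ Ff; rewrite -Jbasis // JJ; apply: EV.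
Qed.

End Bases.

(** * An idempotent and its adjoint *)

Section Idempotent.
Context {R : realType} {H : completeNormedModType R[i]}.
Context (dot : {dot H for Num.conj}) (dot_norm : inner_norm dot).
Context (P : H -> H) (P_idempotent : idempotent_operator P).
Implicit Types (x y z : H) (J U : H -> H).

Local Notation Ps := (adjoint dot P).
Local Notation N0 := (null_space (P + Ps)).
Local Notation N1 := (null_space (2%:R *: idfun - P - Ps)).

Let bP : bounded_operator P := P_idempotent.1.
Let bPs : bounded_operator Ps := bounded_adjoint dot_norm bP.
Let linP : linear P := bP.1.
Let linPs : linear Ps := bPs.1.

Lemma idempotentE x : P (P x) = P x.
Proof. by move/(congr1 (@^~ x)): P_idempotent.2. Qed.

Lemma adjointPs x y : dot (Ps x) y = dot x (P y).
Proof. by rewrite dotC -(adjointP dot_norm) // -dotC. Qed.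

Lemma adjoint_idem x : Ps (Ps x) = Ps x.
Proof.
by apply: (dot_injr dot_norm) => z; rewrite -!(adjointP dot_norm) // idempotentE.
Qed.

Let PP := idempotentE.
Let PsPs := adjoint_idem.
Let adjPs := adjointPs.
Let adjP x y : dot (P x) y = dot x (Ps y) := adjointP dot_norm x y bP.

Lemma closed_null_sum : closed_subspace N0.
Proof. exact: null_closed_subspace (bounded_add bP bPs). Qed.

Lemma closed_null_cosum : closed_subspace N1.
Proof.
apply: null_closed_subspace; do 2!apply: bounded_sub => //.
by apply: bounded_scale; apply: bounded_id.
Qed.

(** Write Q for the adjoint. From Q x = - P x follow Q P x = P x and P Q x = - P x,
hence dot (P x) (P x) = dot x (P x) and dot (Q x) (Q x) = - dot x (P x). But the
two left-hand sides are equal. *)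
Lemma sum_adjoint_eq0 x : P x + Ps x = 0 -> P x = 0 /\ Ps x = 0.
Proof.
move=> h.
have PsE : Ps x = - P x by apply/eqP; rewrite -addr_eq0 addrC h.
have PsPx : Ps (P x) = P x.
  by have := PsPs x; rewrite PsE (linearN_of linPs) => /oppr_inj.
have PPsx : P (Ps x) = - P x by rewrite PsE (linearN_of linP) PP.
have e1 : dot (P x) (P x) = dot x (P x) by rewrite adjP PsPx.
have e2 : dot (P x) (P x) = - dot x (P x).
  have -> : dot (P x) (P x) = dot (Ps x) (Ps x) by rewrite PsE dotNl dotNr opprK.
  by rewrite adjPs PPsx dotNr.
have Px0 : P x = 0.
  have : dot (P x) (P x) + dot (P x) (P x) = 0 by rewrite {1}e1 e2 subrr.
  move/eqP; rewrite -mulr2n mulrn_eq0 /= => /eqP.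
  exact: dot_self_eq0.
by rewrite PsE Px0 oppr0.
Qed.

Lemma null_sumP x : N0 x <-> P x = 0 /\ Ps x = 0.
Proof.
split=> [|[h1 h2]]; first exact: sum_adjoint_eq0.
by rewrite /null_space /= !fctE h1 h2 addr0.
Qed.

End Idempotent.

(** * Symmetries from dimensions, dimensions from unitaries *)

Section Main.
Context {R : realType} {H : completeNormedModType R[i]}.
Context (dot : {dot H for Num.conj}) (dot_norm : inner_norm dot).
Implicit Types (x y z : H) (J U P : H -> H).

Local Notation N0 P := (null_space (P + adjoint dot P)).
Local Notation N1 P := (null_space (2%:R *: idfun - P - adjoint dot P)).

Lemma idempotent_compl P : idempotent_operator P -> idempotent_operator (idfun - P).
Proof.
move=> [bP PP]; split; first by apply: bounded_sub => //; apply: bounded_id.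
apply/funext => x; rewrite /= !fctE (linearB_of bP.1).
by move/(congr1 (@^~ x)): PP => /= ->; rewrite subrr subr0.
Qed.

Lemma adjoint_compl P : bounded_operator P ->
  adjoint dot (idfun - P) = idfun - adjoint dot P.
Proof.
move=> bP; apply: adjoint_unique => //.
  by apply: bounded_sub => //; apply: bounded_id.
by move=> x y; rewrite !fctE dotBl dotBr (adjointP dot_norm _ _ bP).
Qed.

(** Replacing P by I - P exchanges the two null spaces, so that the description of
the second one follows from that of the first. *)
Lemma null_cosum_compl P : bounded_operator P -> N1 P = N0 (idfun - P).
Proof.
move=> bP; rewrite adjoint_compl //; congr null_space.
apply/funext => x; rewrite !fctE scaler_nat mulr2n.
by rewrite [RHS]addrACA -[LHS]addrA.
Qed.

Lemma null_cosumP P x : idempotent_operator P ->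
  N1 P x <-> P x = x /\ adjoint dot P x = x.
Proof.
move=> idP; rewrite null_cosum_compl; last exact: idP.1.
rewrite (null_sumP dot_norm (idempotent_compl idP)) (adjoint_compl idP.1) !fctE.
split=> [[/eqP + /eqP]|[-> ->]]; last by rewrite subrr.
by rewrite !subr_eq0 => /eqP <- /eqP <-.
Qed.

Section FromDimensions.
Context (P : H -> H) (P_idempotent : idempotent_operator P).
Local Notation Ps := (adjoint dot P).

Let bP : bounded_operator P := P_idempotent.1.
Let bPs : bounded_operator Ps := bounded_adjoint dot_norm bP.
Let linP : linear P := bP.1.
Let linPs : linear Ps := bPs.1.
Let PP x : P (P x) = P x := idempotentE P_idempotent x.
Let PsPs x : Ps (Ps x) = Ps x := adjoint_idem dot_norm P_idempotent x.
Let adjP x y : dot (P x) y = dot x (Ps y) := adjointP dot_norm x y bP.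
Let adjPs x y : dot (Ps x) y = dot x (P y) := adjointPs dot_norm P_idempotent x y.

(** Write Q for the adjoint. If P and Q commute at x then u = P x - Q x satisfies
P u + Q u = u. Applying P and Q to this gives P Q u = 0 and Q P u = 0, hence
Q u = 0 and P u = 0, because dot (Q u) (Q u) = dot u (P (Q u)). *)
Lemma commutator_kernel x : Ps (P x) = P (Ps x) -> P x = Ps x.
Proof.
move=> h; pose u := P x - Ps x.
have uE : P u + Ps u = u.
  rewrite /u (linearB_of linP) (linearB_of linPs) PP PsPs h.
  by rewrite subrKA.
have PPsu : P (Ps u) = 0.
  have : P (P u + Ps u) = P u by rewrite uE.
  by rewrite (linearD_of linP) PP => /eqP; rewrite addrC -subr_eq0 addrK => /eqP.
have PsPu : Ps (P u) = 0.
  have : Ps (P u + Ps u) = Ps u by rewrite uE.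
  by rewrite (linearD_of linPs) PsPs => /eqP; rewrite -subr_eq0 addrK => /eqP.
have Psu : Ps u = 0 by apply: (dot_self_eq0 dot_norm); rewrite adjPs PPsu dot0r.
have Pu : P u = 0 by apply: (dot_self_eq0 dot_norm); rewrite adjP PsPu dot0r.
by apply/eqP; rewrite -subr_eq0 -/u -uE Psu Pu addr0.
Qed.

(** The symmetry is glued from J1, which exchanges the null spaces N0 and N1 inside
N, and from the sign J0 of the commutator K. *)
Lemma symmetry_of_same_dim :
  same_hilbert_dim dot (N0 P) (N1 P) ->
  exists2 J, symmetry_operator dot J & forall x, J (P x) = J x - P (J x).
Proof.
have hN0 := closed_null_sum dot_norm P_idempotent.
have hN1 := closed_null_cosum dot_norm P_idempotent.
have N0E := null_sumP dot_norm P_idempotent.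
have N1E x := null_cosumP x P_idempotent.
have orthN x y : N0 P x -> N1 P y -> dot x y = 0.
  move=> /N0E[_ Psx] /N1E[Py _].
  by rewrite -Py -adjPs Psx dot0l.
move=> /(swap_exists dot_norm hN0 hN1 orthN)[J1 [symJ1 J1_N0 J1_N1]].
have [bJ1 _ _] := (symmetry_operatorP dot_norm J1).1 symJ1.
pose K := (Ps \o P) - (P \o Ps).
have bK : bounded_operator K.
  exact: (bounded_sub (bounded_comp bPs bP) (bounded_comp bP bPs)).
have KE x : K x = Ps (P x) - P (Ps x) by [].
have sK : selfadjoint dot K.
  by move=> x y; rewrite !KE dotBl dotBr adjPs adjP adjP adjPs.
have [J0 [symJ0 J0id J0P]] := sign_exists dot_norm bK sK.
have [bJ0 sJ0 _] := (symmetry_operatorP dot_norm J0).1 symJ0.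
pose N := null_space K; have hN : closed_subspace N := null_closed_subspace bK.
have NE x : N x <-> P x = Ps x.
  rewrite /N /null_space /= KE; split=> [/eqP|h].
    by rewrite subr_eq0 => /eqP/commutator_kernel.
  by rewrite h PsPs -h PP h subrr.
have NP x : N x -> N (P x) by move=> /NE h; apply/NE; rewrite PP h PsPs.
have NPs x : N x -> N (Ps x) by move=> Nx; rewrite -(NE x).1 //; apply: NP.
have N0_sub x : N0 P x -> N x by move=> /N0E[h1 h2]; apply/NE; rewrite h1 h2.
have N1_sub x : N1 P x -> N x by move=> /N1E[h1 h2]; apply/NE; rewrite h1 h2.
(* on N the operator P is self-adjoint, so N is the orthogonal sum of N0 and N1 *)
have P_N1 x : N x -> N1 P (P x).
  by move=> /NE h; apply/N1E; rewrite PP h PsPs.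
have coP_N0 x : N x -> N0 P (x - P x).
  move=> /NE h; apply/N0E; rewrite (linearB_of linP) (linearB_of linPs) PP.
  by rewrite h PsPs !subrr.
have J1split x : J1 x = J1 (P x) + J1 (x - P x).
  by rewrite -(linearD_of bJ1.1) addrC subrK.
have J1_N x : N x -> N (J1 x).
  move=> Nx; rewrite J1split; apply: subspaceD => //.
    by apply: N0_sub; apply: J1_N1; apply: P_N1.
  by apply: N1_sub; apply: J1_N0; apply: coP_N0.
have J0_N x : N x -> N (J0 x) by move=> Nx; rewrite J0id.
have [J [symJ JN Jorth]] := glue_symmetries dot_norm hN symJ0 symJ1 J0_N J1_N.
have [bJ _ _] := (symmetry_operatorP dot_norm J).1 symJ.
exists J => // x.
(* J1 (P y) is in N0, where P vanishes, and J1 (y - P y) is in N1, where P is the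
   identity *)
have on_N y : N y -> J (P y) = J y - P (J y).
  move=> Ny; rewrite !JN //; last exact: NP.
  rewrite (J1split y) (linearD_of linP).
  have [-> _] := (N0E _).1 (J1_N1 _ (P_N1 _ Ny)).
  have [-> _] := (N1E _).1 (J1_N0 _ (coP_N0 _ Ny)).
  by rewrite add0r addrK.
have on_orth y : (forall z, N z -> dot y z = 0) -> J (P y) = J y - P (J y).
  move=> yN.
  have PyN z : N z -> dot (P y) z = 0 by move=> Nz; rewrite adjP yN //; apply: NPs.
  have J0yN z : N z -> dot (J0 y) z = 0 by move=> Nz; rewrite sJ0 yN //; apply: J0_N.
  have PJ0yN z : N z -> dot (P (J0 y)) z = 0.
    by move=> Nz; rewrite adjP J0yN //; apply: NPs.
  rewrite (Jorth _ yN) (Jorth _ PyN); apply/eqP; rewrite -subr_eq0; apply/eqP.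
  (* d lies in N as K intertwines P and I - P, and d is orthogonal to N as P and
     J0 preserve the complement of N; hence d = 0 *)
  set d := (X in X = 0); have Nd : N d.
    apply: (J0P P (idfun - P)) => //.
    - by apply: bounded_sub => //; apply: bounded_id.
    - move=> z; rewrite !fctE !KE (linearB_of linP) !PP.
      by rewrite opprB addrA subrK.
    - move=> z; rewrite !fctE !KE !(linearB_of linP, linearB_of linPs) !PP.
      by rewrite subrr sub0r opprB.
  apply: (dot_self_eq0 dot_norm); rewrite {1}/d !dotBl.
  by rewrite (sJ0 (P y)) (PyN _ (J0_N _ Nd)) J0yN // PJ0yN // !subrr.
have wN z : N z -> dot (x - orth_proj dot N x) z = 0 by apply: proj_orth.
have Nq : N (orth_proj dot N x) by apply: proj_in.
rewrite -[x](subrK (orth_proj dot N x)); move: wN Nq.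
move: (orth_proj dot N x) (x - orth_proj dot N x) => q w wN Nq.
rewrite !(linearD_of linP, linearD_of bJ.1) (on_N _ Nq) (on_orth _ wN).
by rewrite opprD addrACA.
Qed.

End FromDimensions.

(** Taking adjoints in U P = (I - P) U shows that the same relation holds for the
adjoint of P, so that U maps N0 onto N1. *)
Lemma same_dim_of_unitary P U : idempotent_operator P ->
  unitary_operator dot U -> U \o P \o adjoint dot U = idfun - P ->
  same_hilbert_dim dot (N0 P) (N1 P).
Proof.
move=> idP [bU UUs UsU] UPU.
have bP := idP.1; have bPs := bounded_adjoint dot_norm bP.
have UUsE x : U (adjoint dot U x) = x by move/(congr1 (@^~ x)): UUs.
have UsUE x : adjoint dot U (U x) = x by move/(congr1 (@^~ x)): UsU.
have isoU x y : dot (U x) (U y) = dot x y by rewrite adjointP // UsUE.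
have UP x : U (P x) = U x - P (U x).
  by move/(congr1 (@^~ (U x))): UPU; rewrite /= UsUE.
have UPs x : U (adjoint dot P x) = U x - adjoint dot P (U x).
  apply: (dot_injr dot_norm) => y; rewrite dotBr -adjointP //.
  rewrite -[y]UUsE isoU -adjointP // -isoU UP dotBl !UUsE; congr (_ - _).
have N0E := null_sumP dot_norm idP; have N1E x := null_cosumP x idP.
have hN0 := closed_null_sum dot_norm idP.
have hN1 := closed_null_cosum dot_norm idP.
have U_N0 x : N0 P x -> N1 P (U x).
  move=> /N0E[Px Psx]; have := UP x; have := UPs x.
  rewrite Px Psx (linear0_of bU.1) => /eqP + /eqP.
  by rewrite !(eq_sym 0) !subr_eq0 => /eqP h1 /eqP h2; apply/N1E.
have U_N1 y : N1 P y -> exists2 x, N0 P x & U x = y.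
  move=> /N1E[Py Psy]; exists (adjoint dot U y) => //.
  have U0 z : U z = 0 -> z = 0.
    by move=> h; rewrite -[z]UsUE h (linear0_of (bounded_adjoint dot_norm bU).1).
  by apply/N0E; split; apply: U0; rewrite ?UP ?UPs UUsE ?Py ?Psy subrr.
have [E bE] := orthonormal_basis_exists dot_norm hN0.
exists E, (U @` E); split=> //.
  exact: (unitary_image_basis hN1 bU isoU U_N0 U_N1 bE).
apply/card_set_bijP; exists U.
split=> [e Ee|e f _ _ eqU|]; [by exists e| |exact: subset_refl].
by rewrite -[e]UsUE eqU UsUE.
Qed.

End Main.

(** * The equivalence *)

Lemma symmetry_unitary (R : realType) (H : completeNormedModType R[i])
    (dot : {dot H for Num.conj}) (J : H -> H) :
  symmetry_operator dot J -> unitary_operator dot J.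
Proof. by case=> bJ aJ JJ; split; rewrite // -aJ. Qed.

Theorem theorem2p6 (R : realType) (H : completeNormedModType R[i])
    (dot : {dot H for Num.conj}) (dot_norm : inner_norm dot)
    (H_separable : separable_space H)
    (P : H -> H) (P_idempotent : idempotent_operator P) :
  [<-> (exists2 J : H -> H, symmetry_operator dot J & J \o P \o J = idfun - P);
       same_hilbert_dim dot (null_space (P + adjoint dot P))
                            (null_space (2%:R *: idfun - P - adjoint dot P));
       (exists2 U : H -> H, unitary_operator dot U
                          & U \o P \o adjoint dot U = idfun - P)].
Proof.
have sym_of_dim : same_hilbert_dim dot (null_space (P + adjoint dot P))
      (null_space (2%:R *: idfun - P - adjoint dot P)) ->
    exists2 J : H -> H, symmetry_operator dot J & J \o P \o J = idfun - P.
  move=> /(symmetry_of_same_dim dot_norm P_idempotent)[J symJ JP].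
  exists J => //; have [_ _ JJ] := (symmetry_operatorP dot_norm J).1 symJ.
  by apply/funext => x; rewrite /= JP !JJ.
have unitary_of_sym :
    (exists2 J : H -> H, symmetry_operator dot J & J \o P \o J = idfun - P) ->
    exists2 U : H -> H, unitary_operator dot U
                      & U \o P \o adjoint dot U = idfun - P.
  move=> [J symJ JPJ]; exists J; first exact: symmetry_unitary.
  by have [_ <- _] := symJ.
have dim_of_unitary U := @same_dim_of_unitary R H dot dot_norm P U P_idempotent.
tfae.
- by move=> /unitary_of_sym[U]; apply: dim_of_unitary.
- by move=> /sym_of_dim/unitary_of_sym.
- by move=> [U unU UPU]; apply/sym_of_dim/(dim_of_unitary U).
Qed.
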